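(* For every $z\in\mathcal A_r^R$, the complex derivative $(\partial_{z_j}u(z),\partial_{z_j}p(z))$ with respect to $z_j$, for each $j\ge1$, is well-defined for the solution $(u(z),p(z))$ of the parametric saddle point problem, and it is given by: find $(\partial_{z_j}u(z),\partial_{z_j}p(z))\in\mathcal V\times\mathcal Q$ such that $$\begin{aligned}a(\partial_{z_j}u,v;\kappa)+b(v,\partial_{z_j}p)&=-a(u,v;\kappa_j)&&\forall v\in\mathcal V,\\ b(\partial_{z_j}u,q)&=0&&\forall q\in\mathcal Q,\end{aligned}$$ where $u=u(z)$, $p=p(z)$, $\kappa=\kappa(\cdot,z)$, and where, by a slight abuse of notation, $a(u,v;\kappa_j)$ on the right-hand side denotes only the part of the form that is linear in the parameter, i.e. $a_1(u,v;\kappa_j)$.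
   Context: Spaces and problem. $D$ is the physical domain (an open bounded set in $\mathbb R^d$, $d=2,3$, with Lipschitz boundary). $\mathcal V,\mathcal Q$ are Hilbert spaces with duals $\mathcal V',\mathcal Q'$, and $\mathcal K$ is a separable Banach space, whose elements $\kappa$ are functions on $D$. Given $\kappa\in\mathcal K$, $f\in\mathcal V'$, $g\in\mathcal Q'$, the parametric saddle point problem is: find $(u,p)\in\mathcal V\times\mathcal Q$ such that $a(u,v;\kappa)+b(v,p)=f(v)$ for all $v\in\mathcal V$ and $b(u,q)=g(q)$ for all $q\in\mathcal Q$. Here $a(\cdot,\cdot;\kappa):\mathcal V\times\mathcal V\to\mathbb R$ is a parametric bilinear form and $b:\mathcal V\times\mathcal Q\to\mathbb R$ is a bilinear form. Let $\mathcal V^0=\{v\in\mathcal V:b(v,q)=0\ \forall q\in\mathcal Q\}$. Assumptions on the forms. There are constants $\gamma,\alpha>0$ independent of $\kappa$ and $\delta,\beta>0$ such that $a(w,v;\kappa)\le\gamma\|w\|_{\mathcal V}\|v\|_{\mathcal V}$ for all $w,v\in\mathcal V$; $b(v,q)\le\delta\|v\|_{\mathcal V}\|q\|_{\mathcal Q}$ for all $v\in\mathcal V,q\in\mathcal Q$; $a(v,v;\kappa)\ge\alpha\|v\|_{\mathcal V}^2$ for all $v\in\mathcal V^0$; and $\inf_{q\in\mathcal Q}\sup_{v\in\mathcal V}\frac{b(v,q)}{\|v\|_{\mathcal V}\|q\|_{\mathcal Q}}\ge\beta$. Affine structure of $a$. $a(w,v;\kappa)=a_0(w,v)+a_1(w,v;\kappa)$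 for all $w,v\in\mathcal V$, where $a_1(w,v;\kappa)$ depends linearly on $\kappa$ and, for constants $c_1,C_1>0$ independent of $\kappa$ and any $\kappa\in\mathcal K$: $a_1(v,v;\kappa)\ge c_1\operatorname{ess\,inf}_{x\in D}|\kappa(x)|\,\|v\|_{\mathcal V}^2$ for all $v\in\mathcal V^0$; $a_1(w,v;\kappa)\le C_1\operatorname{ess\,sup}_{x\in D}|\kappa(x)|\,\|w\|_{\mathcal V}\|v\|_{\mathcal V}$ for all $w,v\in\mathcal V$; $a_1(w,v;\kappa)\le\frac12\big(a_1(w,w;|\kappa|)+a_1(v,v;|\kappa|)\big)$ for all $w,v\in\mathcal V$. Affine parametrization. $U=[-1,1]^{\mathbb N}$ and $\kappa(x,y)=\kappa_0(x)+\sum_{j\ge1}y_j\kappa_j(x)$ for $(x,y)\in D\times U$, with $\kappa_j\in\mathcal K$ for all $j\ge0$. There are constants $0<\theta<\Theta<\infty$ such that $\theta<\kappa_{\min}:=\inf_{(x,y)\in D\times U}\kappa(x,y)\le\sup_{(x,y)\in D\times U}\kappa(x,y)=:\kappa_{\max}<\Theta/2$, and such that the coercivity and continuity conditions above are satisfied for $a(\cdot,\cdot;\kappa)$ at any $\kappa\in[\theta,\Theta]$. Complex extension. For complex sequences $z$ write $\kappa(x,z)=\kappa_0(x)+\sum_{j\ge1}z_j\kappa_j(x)$. Fix $r,R$ with $0<\theta<r<\kappa_{\min}<2\kappa_{\max}<R<\Theta<\infty$ and set $\mathcal A_r^R=\{z\in\mathbb C^{\mathbb N}:r\le|\kappa(x,z)|\le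 R\text{ for every }x\in D\}$. Under the assumptions above, for every $z\in\mathcal A_r^R$ the problem at $\kappa(\cdot,z)$ has a unique solution, denoted $(u(z),p(z))\in\mathcal V\times\mathcal Q$. The complex derivative with respect to $z_j$ is the limit in $\mathcal V\times\mathcal Q$, as $|h|\to0$ with $h\in\mathbb C\setminus\{0\}$, of the difference quotients $\frac{u(z+he_j)-u(z)}h$ and $\frac{p(z+he_j)-p(z)}h$, where $e_j$ is the Kronecker sequence with $1$ at index $j$ and $0$ elsewhere. *)

(* Defs.v *)
From HB Require Import structures.
From mathcomp Require Export all_boot all_order all_algebra.
From mathcomp Require Export all_classical all_reals all_analysis.
From mathcomp Require Export complex.

#[global] Set Implicit Arguments.
#[global] Unset Strict Implicit.
#[global] Unset Printing Implicit Defensive.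

Export Order.TTheory GRing.Theory Num.Theory numFieldNormedType.Exports.
#[global] Open Scope classical_set_scope.
#[global] Open Scope ring_scope.
#[global] Open Scope complex_scope.

Notation bilinear_form V Q R := {bilinear V -> Q -> R | *%R & *%R}.

Section Domain.
Variables (R : realType) (d : nat).
Implicit Types (D : set 'rV[R]_d) (x e : 'rV[R]_d).

Definition dotp x e : R := \sum_(i < d) x 0 i * e 0 i.

(* Near each boundary point, D is the strict epigraph, in some unit direction
   e, of a Lipschitz function of the component orthogonal to e. *)
Definition lipschitz_boundary D : Prop :=
  forall p, (closure D `\` interior D) p ->
    exists (e : 'rV[R]_d) (phi : 'rV[R]_d -> R),
      [/\ dotp e e = 1,
          [lipschitz phi s | s in [set: 'rV[R]_d]] &
          \forall x \near p, D x <-> phi (x - dotp x e *: e) < dotp x e].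

(* The library has Lebesgue measure on R only; null sets of R^d are those of
   the Lebesgue outer measure built from coverings by boxes. *)
Definition box (a b : 'rV[R]_d) : set 'rV[R]_d :=
  [set x | forall i, a 0 i < x 0 i <= b 0 i].

Definition box_volume (a b : 'rV[R]_d) : R :=
  \prod_(i < d) Num.max 0 (b 0 i - a 0 i).

Definition lebesgue_outer (A : set 'rV[R]_d) : \bar R :=
  ereal_inf [set s | exists a b : nat -> 'rV[R]_d,
    A `<=` \bigcup_k box (a k) (b k) /\
    s = (\sum_(0 <= k <oo) (box_volume (a k) (b k))%:E)%E].

Definition ess_sup_on D (f : 'rV[R]_d -> R) : \bar R :=
  ereal_inf [set m | lebesgue_outer [set x | D x /\ (m < (f x)%:E)%E] = 0%E].

Definition ess_inf_on D (f : 'rV[R]_d -> R) : \bar R :=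
  ereal_sup [set m | lebesgue_outer [set x | D x /\ ((f x)%:E < m)%E] = 0%E].

End Domain.

Section Spaces.
Variable R : realType.

(* The norm of V comes from an inner product; with completeness, V is a real
   Hilbert space. *)
Definition hilbertian (V : normedModType R) : Prop :=
  exists ip : V -> V -> R,
    [/\ forall w, scalar (ip^~ w),
        forall v w, ip v w = ip w v &
        forall v, ip v v = `|v| ^+ 2].

Definition separable (T : topologicalType) : Prop :=
  exists S : set T, countable S /\ dense S.

Variables V Q : normedModType R.

Definition kernel_of (b : V -> Q -> R) : set V :=
  [set v | forall q, b v q = 0].

(* Quotients with v = 0 or q = 0 are 0 / 0 and are excluded. *)
Definition inf_sup (b : V -> Q -> R) : \bar R :=
  ereal_inf [set ereal_sup [set (b v q / (`|v| * `|q|))%:E | v in [set v | v != 0]]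
            | q in [set q | q != 0]].

End Spaces.

(* The complexification of a real space V is V * V, where (v1, v2) stands for
   v1 + i v2; the functions below give its scalar multiplication and the
   complex-(bi)linear extensions of real functionals and forms. *)
Section Complexification.
Variable R : realType.

Definition cscale (V : lmodType R) (c : R[i]) (v : V * V) : V * V :=
  (complex.Re c *: v.1 - complex.Im c *: v.2,
   complex.Re c *: v.2 + complex.Im c *: v.1).

Definition clin (V : lmodType R) (f : V -> R) (v : V * V) : R[i] :=
  f v.1 +i* f v.2.

Definition cbilin (V Q : lmodType R) (b : V -> Q -> R)
    (v : V * V) (q : Q * Q) : R[i] :=
  (b v.1 q.1 - b v.2 q.2) +i* (b v.1 q.2 + b v.2 q.1).

End Complexification.

Section Parametrization.
Variables (R : realType) (d : nat) (D : set 'rV[R]_d).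
Variables (K : lmodType R) (ev : K -> 'rV[R]_d -> R) (kap : nat -> K).

(* Sequences y_1, y_2, ... are indexed from 0: y j is the coefficient of the
   function kap j.+1. *)
Definition param_box : set (nat -> R) := [set y | forall j, -1 <= y j <= 1].

Definition kappa_sum (y : nat -> R) (x : 'rV[R]_d) (n : nat) : R :=
  ev (kap 0) x + \sum_(j < n) y j * ev (kap j.+1) x.

Definition kappa_real (y : nat -> R) (x : 'rV[R]_d) : R :=
  limn (kappa_sum y x).

Definition kappa_values : set (\bar R) :=
  [set t | exists (x : 'rV[R]_d) (y : nat -> R),
    [/\ D x, param_box y & t = (kappa_real y x)%:E]].

Definition kappa_min : \bar R := ereal_inf kappa_values.
Definition kappa_max : \bar R := ereal_sup kappa_values.

Definition kappa_csum (z : nat -> R[i]) (x : 'rV[R]_d) (n : nat) : R[i] :=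
  (ev (kap 0) x)%:C + \sum_(j < n) z j * (ev (kap j.+1) x)%:C.

Definition cval (k : K * K) (x : 'rV[R]_d) : R[i] := ev k.1 x +i* ev k.2 x.

(* k is the function kappa(., z), i.e. the pointwise sum of the series. *)
Definition is_kappa (z : nat -> R[i]) (k : K * K) : Prop :=
  forall x, D x -> kappa_csum z x @ \oo --> (cval k x : R[i]^o).

Definition annulus (r rho : R) : set (nat -> R[i]) :=
  [set z | exists2 k, is_kappa z k &
           forall x, D x -> r%:C <= `|cval k x| <= rho%:C].

End Parametrization.

Section Problem.
Variables (R : realType) (d : nat) (D : set 'rV[R]_d).
Variables (K : lmodType R) (ev : K -> 'rV[R]_d -> R) (kap : nat -> K).
Variables (V Q : normedModType R).
Variables (a0 : V -> V -> R) (a1 : K -> V -> V -> R) (b : V -> Q -> R).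

Definition aform (k : K) (w v : V) : R := a0 w v + a1 k w v.

(* The extension of aform to complex functions and arguments; the part a1 is
   complex-linear in the function. *)
Definition caform (k : K * K) (w v : V * V) : R[i] :=
  cbilin a0 w v + (cbilin (a1 k.1) w v + (0 +i* 1) * cbilin (a1 k.2) w v).

(* The existential picks kappa(., z), which is unique when ev is injective on D;
   without such a k the problem has no solution. *)
Definition saddle_point (z : nat -> R[i]) (F : V * V -> R[i]) (G : Q * Q -> R[i])
    (s : (V * V) * (Q * Q)) : Prop :=
  exists2 k, is_kappa D ev kap z k &
    (forall v, caform k s.1 v + cbilin b v s.2 = F v) /\
    (forall q, cbilin b s.1 q = G q).

End Problem.

Definition shift (R : realType) (z : nat -> R[i]) (j : nat) (h : R[i]) : nat -> R[i] :=
  fun i => z i + h * (i == j)%:R.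

Definition complex_derivative (R : realType) (V : normedModType R)
    (u : (nat -> R[i]) -> V * V) (z : nat -> R[i]) (j : nat) (du : V * V) : Prop :=
  cscale h^-1 (u (shift z j h) - u z) @[h --> (0 : R[i]^o)^'] --> du.

(* Main.v *)
From HB Require Import structures.
Require Import Defs.
From mathcomp Require Import ring lra.
Import Normc.

(* Let N w be the solution of the problem at z with data (- a1(w, .; kappa_j), 0).
   It exists, and is unique, by well-posedness for real data, and N is bounded
   by the closed graph theorem. By affinity in the parameter, s solves the
   problem at z + h e_j iff s = s0 + h N u, where s0 is the solution at z and u
   is the first component of s. For small h the map u |-> u0 + h N u is a
   contraction, so s exists and is unique, u tends to u0, and the difference
   quotient (s - s0) / h = N u tends to N u0. *)

(** * The closed graph theorem *)

HB.instance Definition _ (R : realType) (U V : completeNormedModType R) :=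
  Pointed.on (U * V)%type.

(** Both projections of a Cauchy filter are Cauchy, and their limits form its limit. This makes the
    complexified spaces complete, as Baire's theorem and the fixed point theorem require. *)
Lemma prod_cauchy_cvg (R : realType) (U V : completeNormedModType R)
  (F : set_system (U * V)) : ProperFilter F -> cauchy F -> cvg F.
Proof.
move=> FF /cauchy_ballP cF.
have c1 : cvg (fst @ F).
  apply: cauchy_cvg; apply/cauchy_ballP => e e0.
  have [[/= A B] [FA FB] AB] := cF e e0.
  exists (fst @` A, fst @` B) => /=.
    split; [apply: filterS FA|apply: filterS FB] => x ?; exact: imageP.
  by move=> [_ _] [/= [x Ax <-] [y By <-]]; have [] := AB (x, y) (conj Ax By).
have c2 : cvg (snd @ F).
  apply: cauchy_cvg; apply/cauchy_ballP => e e0.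
  have [[/= A B] [FA FB] AB] := cF e e0.
  exists (snd @` A, snd @` B) => /=.
    split; [apply: filterS FA|apply: filterS FB] => x ?; exact: imageP.
  by move=> [_ _] [/= [x Ax <-] [y By <-]]; have [] := AB (x, y) (conj Ax By).
have /cvg_ex[/= l Fl] := c1; have /cvg_ex[/= m Fm] := c2.
apply/cvg_ex; exists (l, m) => /=.
apply: (cvg_trans _ (cvg_pair Fl Fm)) => A.
rewrite /fmap/= => FA; have : F [set x | A (x.1, x.2)] by exact: FA.
by apply: filterS => -[].
Qed.

HB.instance Definition _ (R : realType) (U V : completeNormedModType R) :=
  Uniform_isComplete.Build (U * V)%type (@prod_cauchy_cvg R U V).

Lemma half_geometric_cvg (R : realType) (C : R) :
  C / 2 ^+ k @[k --> \oo] --> (0 : R).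
Proof.
under eq_fun do rewrite -exprVn.
apply: (@cvg_geometric _ C 2^-1).
by rewrite ger0_norm ?invr_ge0// invf_lt1// ltr1n.
Qed.

Section ClosedGraph.
Variables (R : realType) (X Y : completeNormedModType R) (S : {linear X -> Y}).

(* By Baire, some set [|S x| <= n] is dense in a ball; differences of its points
   approximate every vector of a ball around 0. *)
Lemma linear_almost_bounded : exists2 c : R, 0 <= c &
  forall (t : R) (x : X), `|x| < t ->
  exists2 x', `|x - x'| < t / 2 & `|S x'| <= c * t.
Proof.
pose E n := closure [set x : X | `|S x| <= n%:R].
(* If every complement were dense, Baire's theorem would give a point outside all [E n], yet [x]
   lies in [E n] once [n] exceeds [|S x|]. *)
have [n nd] : exists n, ~ dense (~` E n).
  apply/existsNP => dE.
  have /Baire : forall i, open (~` E i) /\ dense (~` E i).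
    by move=> i; split=> //; apply: closed_openC; exact: closed_closure.
  move=> /(_ setT); case; [by exists 0|exact: openT|].
  move=> x [_ /(_ (Num.truncn `|S x|).+1 I)]; apply; apply: subset_closure => /=.
  exact/ltW/truncnS_gt.
have [W [[x0 [Oop Ox0]] OE]] := denseNE nd.
have /nbhs_ballP[r /= r0 rO] : nbhs x0 W by apply: open_nbhs_nbhs.
have approx y e : ball x0 r y -> 0 < e -> exists2 a, `|y - a| < e & `|S a| <= n%:R.
  move=> /rO Oy e0; have Ey : E n y.
    by apply: contrapT => nE; have : (W `&` ~` E n) y by []; rewrite OE.
  have [a [Ha ya]] := Ey _ (nbhsx_ballx y e e0).
  by exists a => //; move: ya; rewrite -ball_normE.
(* Scaling by [s = r / t] brings [x] into the ball of radius [r]. Two errors [r / 4] scale back to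
   [t / 2], and two images of norm at most [n] scale back to [2 * n * t / r], which is at most
   [c * t]. *)
exists (4 * n%:R / r); first by rewrite divr_ge0 ?mulr_ge0// ltW.
move=> t x xt; have t0 : 0 < t by rewrite (le_lt_trans _ xt).
pose s := r / t; have s0 : 0 < s by rewrite divr_gt0.
have [||a xa Sa] := approx (x0 + s *: x) (r / 4).
- rewrite -ball_normE /= opprD addNKr normrN normrZ gtr0_norm//.
  by rewrite /s mulrAC ltr_pdivrMr// ltr_pM2l.
- by rewrite divr_gt0.
have [||b xb Sb] := approx x0 (r / 4); first exact: ballxx.
  by rewrite divr_gt0.
exists (s^-1 *: (a - b)).
  have -> : x - s^-1 *: (a - b) = s^-1 *: ((x0 + s *: x - a) - (x0 - b)).
    have -> : x0 + s *: x - a - (x0 - b) = s *: x - (a - b).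
      by rewrite !opprB [LHS]addrC !addrA subrK (addrC b).
    by rewrite [RHS]scalerBr scalerA mulVf ?gt_eqF// scale1r.
  rewrite normrZ gtr0_norm ?invr_gt0// mulrC ltr_pdivrMr//.
  rewrite (le_lt_trans (ler_normB _ _))//.
  have -> : t / 2 * s = r / 4 + r / 4.
    by rewrite /s; field; rewrite gt_eqF.
  exact: ltrD.
rewrite linearZ linearB normrZ gtr0_norm ?invr_gt0// mulrC ler_pdivrMr//.
have -> : 4 * n%:R / r * t * s = 4 * n%:R.
  by rewrite /s; field; rewrite !gt_eqF.
rewrite (le_trans (ler_normB _ _))// (le_trans (lerD Sa Sb))//.
by have := ler0n R n; lra.
Qed.

(** The increments are dominated by a geometric series whose tail from index [k] is
    [2 * C / 2 ^+ k]. *)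
Lemma geometric_increments_cvg (y : Y^nat) (C : R) :
  (forall k, `|y k.+1 - y k| <= C / 2 ^+ k) ->
  cvgn y /\ forall k, `|y k - y 0%N| <= 2 * C.
Proof.
move=> yC; have C0 : 0 <= C.
  by have := yC 0%N; rewrite expr0 divr1; apply: le_trans.
(* Subtracting the remaining tail gives the exact partial geometric sum, so that the induction on
   [m] closes. *)
have tail k m : `|y (k + m)%N - y k| <= 2 * C / 2 ^+ k - 2 * C / 2 ^+ (k + m).
  elim: m => [|m IH]; first by rewrite addn0 !subrr normr0.
  rewrite addnS -(subrK (y (k + m)%N) (y _.+1)) -addrA.
  rewrite (le_trans (ler_normD _ _))// (le_trans (lerD (yC _) IH))//.
  have p0 : 2 ^+ (k + m) != 0 :> R by rewrite expf_neq0.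
  have -> : C / 2 ^+ (k + m) = 2 * C / 2 ^+ (k + m).+1.
    by rewrite exprS; field.
  have -> : 2 * C / 2 ^+ (k + m) = 2 * (2 * C / 2 ^+ (k + m).+1).
    by rewrite exprS; field.
  lra.
have tail' k m : `|y (k + m)%N - y k| <= 2 * C / 2 ^+ k.
  rewrite (le_trans (tail k m))// lerBlDr lerDl.
  by rewrite divr_ge0 ?mulr_ge0 ?exprn_ge0.
split; last first.
  by move=> k; have := tail' 0%N k; rewrite expr0 divr1.
apply/cauchy_cvgP/cauchy_exP => e e0.
have /cvgr0_norm_lt /(_ e e0)[k _ kP] := half_geometric_cvg (2 * C).
exists (y k), k => // m /= km.
rewrite -ball_normE /= distrC -(subnKC km).
apply: (le_lt_trans (tail' _ _)); apply: le_lt_trans (kP k _) => //=.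
exact: ler_norm.
Qed.

Theorem closed_graph :
  (forall (x : X^nat) (x0 : X) (y0 : Y),
     x @ \oo --> x0 -> S (x k) @[k --> \oo] --> y0 -> y0 = S x0) ->
  exists2 c : R, 0 <= c & forall x, `|S x| <= c * `|x|.
Proof.
move=> Scl; have [c c0 approx] := linear_almost_bounded.
exists (2 * c); first by rewrite mulr_ge0.
move=> x; apply/ler_addgt0Pr => e e0.
(* The approximation asks for a strict bound [|x| < t]; the slack [d] costs at most [e] in the final
   estimate. *)
have [d d0 dP] : exists2 d, 0 < d & 2 * c * (`|x| + d) <= 2 * c * `|x| + e.
  exists (e / (2 * c + 1)); first by rewrite divr_gt0// ltr_wpDl// mulr_ge0.
  rewrite mulrDr lerD2l mulrCA ger_pMr// ler_pdivrMr; last first.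
    by rewrite ltr_wpDl// mulr_ge0.
  by rewrite mul1r lerDl.
apply: le_trans dP; set t := `|x| + d.
have xt : `|x| < t by rewrite ltrDl.
(* The choice is total, with dummy value 0 where no approximation is claimed, so the iteration can
   be defined before its error bound is proved. *)
have /choice[g gP] : forall p : R * X, exists x', `|p.2| < p.1 ->
    `|p.2 - x'| < p.1 / 2 /\ `|S x'| <= c * p.1.
  move=> [s w] /=.
  have [/approx[w' ? ?]|_] := boolP (`|w| < s); last by exists 0.
  by exists w'.
(* Successive approximation: each step halves the error in [x], so the images
   converge geometrically and closedness identifies their limit with [S x]. *)
pose a := fix a k := if k is k'.+1 then a k' + g (t / 2 ^+ k', x - a k') else 0.
have ax k : `|x - a k| < t / 2 ^+ k.
  elim: k => [|k IH]; first by rewrite subr0 expr0 divr1.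
  rewrite [a _]/= opprD addrA exprSr invfM mulrA.
  by have [] := gP (_, _) IH.
have aS k : `|S (a k.+1) - S (a k)| <= c * t / 2 ^+ k.
  by rewrite -linearB/= addrC addKr -mulrA; have [] := gP (_, _) (ax k).
have [Sa Sb] := geometric_increments_cvg aS.
have cvgax : a @ \oo --> x.
  apply/cvgrPdist_lt => s s0.
  have /cvgr0_norm_lt /(_ s s0) := half_geometric_cvg t.
  apply: filterS => k; apply: le_lt_trans.
  by rewrite (le_trans (ltW (ax k)))// ler_norm.
have /cvg_ex[/= l Sl] := Sa.
rewrite -(Scl _ _ _ cvgax Sl) -mulrA.
apply: (closed_cvg _ (@closed_le _ (2 * (c * t)))) (cvg_norm Sl).
apply: nearW => k /=.
by have := Sb k; rewrite linear0 subr0.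
Qed.

End ClosedGraph.

(** The map [x |-> y + T x] is a contraction with constant [q], so the Banach fixed point theorem
    applies. *)
Lemma neumann_surjective (R : realType) (X : completeNormedModType R)
    (T : {linear X -> X}) (q : R) :
  0 <= q < 1 -> (forall x, `|T x| <= q * `|x|) -> forall y, exists x, x = y + T x.
Proof.
move=> /andP[q0 q1] Tq y.
pose f := fun x : X => y + T x.
have fS : set_fun setT setT f by [].
pose F : {fun [set: X] >-> [set: X]} := HB.pack f (isFun.Build _ _ _ _ f fS).
have ctr : is_contraction F.
  exists (NngNum q0); split => //= -[a b] _ /=.
  by rewrite /f opprD addrACA subrr add0r -linearB.
have [||x _ xE] := banach_fixed_point ctr; [exact: closedT|by exists y|].
by exists x.
Qed.

Lemma norm_fst_le (R : realType) (V Q : normedModType R) (v : V * Q) :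
  `|v.1| <= `|v|.
Proof. by rewrite prod_normE le_max lexx. Qed.

Lemma norm_snd_le (R : realType) (V Q : normedModType R) (v : V * Q) :
  `|v.2| <= `|v|.
Proof. by rewrite prod_normE le_max lexx orbT. Qed.

(** * Complexified forms *)

Section ComplexScaling.
Variables (R : realType) (V : lmodType R).
Implicit Types (c h : R[i]) (v w : V * V).

Lemma cscaleDr c v w : cscale c (v + w) = cscale c v + cscale c w.
Proof.
by rewrite /cscale; congr pair; rewrite !scalerDr ?opprD addrACA.
Qed.

Lemma cscaleN c v : cscale c (- v) = - cscale c v.
Proof. by rewrite /cscale; congr pair; rewrite !scalerN opprD ?opprK. Qed.

Lemma cscaleB c v w : cscale c (v - w) = cscale c v - cscale c w.
Proof. by rewrite cscaleDr cscaleN. Qed.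

Lemma cscaleA c h v : cscale c (cscale h v) = cscale (c * h) v.
Proof.
case: c h => [a b] [a' b']; rewrite /cscale /=; congr pair.
  rewrite scalerBr scalerDr !scalerA scalerBl scalerDl !opprD !addrA.
  by rewrite [LHS](ACl (1*4*2*3)).
rewrite scalerBr scalerDr !scalerA scalerBl scalerDl !addrA.
by rewrite [LHS](ACl (1*4*2*3)).
Qed.

Lemma cscale_real (a : R) v : cscale a%:C v = a *: v.
Proof. by rewrite /cscale /= !scale0r subr0 addr0. Qed.

Lemma cscale1 v : cscale 1 v = v.
Proof. by rewrite cscale_real scale1r. Qed.

End ComplexScaling.

Section Normc.
Variable R : realType.
Implicit Types c x : R[i].

Lemma normc_normE x : `|x| = (normc x)%:C. Proof. by case: x. Qed.

Lemma normc_ge0 x : 0 <= normc x. Proof. by case: x => a b; exact: sqrtr_ge0. Qed.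

Lemma Re_le_normc x : `|complex.Re x| <= normc x.
Proof. by have := normc_ge_Re x; rewrite normc_normE lecR. Qed.

Lemma Im_le_normc x : `|complex.Im x| <= normc x.
Proof.
case: x => a b /=.
by rewrite -sqrtr_sqr ler_sqrt// ?lerDr ?addr_ge0 ?sqr_ge0.
Qed.

Lemma normc_le x : normc x <= `|complex.Re x| + `|complex.Im x|.
Proof.
case: x => a b /=.
rewrite -[leRHS]ger0_norm ?addr_ge0// -sqrtr_sqr ler_sqrt ?sqr_ge0//.
by rewrite sqrrD !real_normK ?num_real// addrAC lerDl mulrn_wge0// mulr_ge0.
Qed.

(** The product carries the max norm, and each component of [cscale c v] is a sum of two terms of
    size at most [normc c * |v|]; hence the factor 2. *)
Lemma norm_cscale (V : normedModType R) c (v : V * V) :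
  `|cscale c v| <= 2 * normc c * `|v|.
Proof.
have v1 := norm_fst_le v; have v2 := norm_snd_le v.
have := Re_le_normc c; have := Im_le_normc c; set n := normc c => cI cR.
rewrite [`|cscale _ _|]prod_normE/= ge_max; apply/andP; split.
  rewrite (le_trans (ler_normB _ _))// !normrZ -mulrA mulrDl mul1r.
  by rewrite lerD// ler_pM.
rewrite (le_trans (ler_normD _ _))// !normrZ -mulrA mulrDl mul1r.
by rewrite lerD// ler_pM.
Qed.

End Normc.

Section ComplexForms.
Variable R : realType.

(** Complex scalars act on [V * V] through [cscale] only, so complex linearity is spelled out, with
    one combination per argument for both additivity and homogeneity. *)
Definition complex_bilinear (V Q : lmodType R) (B : V * V -> Q * Q -> R[i]) :=
  (forall c v w q, B (cscale c v + w) q = c * B v q + B w q) /\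
  (forall c v q r, B v (cscale c q + r) = c * B v q + B v r).

Definition bounded_form (V Q : normedModType R) (B : V * V -> Q * Q -> R[i]) :=
  exists2 M : R, 0 <= M & forall v q, normc (B v q) <= M * `|v| * `|q|.

Lemma complex_bilinear0l (V Q : lmodType R) (B : V * V -> Q * Q -> R[i]) q :
  complex_bilinear B -> B 0 q = 0.
Proof.
move=> [Bl _]; have := Bl 1 0 0 q; rewrite cscale1 addr0 mul1r => /eqP.
by rewrite -subr_eq0 opprD addNKr oppr_eq0 => /eqP.
Qed.

Lemma complex_bilinear0r (V Q : lmodType R) (B : V * V -> Q * Q -> R[i]) v :
  complex_bilinear B -> B v 0 = 0.
Proof.
move=> [_ Br]; have := Br 1 v 0 0; rewrite cscale1 addr0 mul1r => /eqP.
by rewrite -subr_eq0 opprD addNKr oppr_eq0 => /eqP.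
Qed.

Lemma cbilin_bilinear (V Q : lmodType R) (b : bilinear_form V Q R) :
  complex_bilinear (cbilin b).
Proof.
split=> -[x y] [v1 v2] [w1 w2] [q1 q2]; apply/eqP; rewrite eq_complex /cbilin /=.
  rewrite !(linearDl, linearBl, linearNl) /= !linearZl_LR /=.
  by apply/andP; split; apply/eqP; ring.
rewrite !linearD !linearN /= !linearZr_LR /=.
by apply/andP; split; apply/eqP; ring.
Qed.

(** [cbilin b] consists of four real terms, each at most [M * |v| * |q|] in the max norms; hence the
    constant [4 * M]. *)
Lemma cbilin_bounded (V Q : normedModType R) (b : V -> Q -> R) (M : R) :
  0 <= M -> (forall v q, `|b v q| <= M * `|v| * `|q|) -> bounded_form (cbilin b).
Proof.
move=> M0 bM; exists (4 * M) => [|v q]; first by rewrite mulr_ge0.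
have bb x y : `|x| <= `|v| -> `|y| <= `|q| -> `|b x y| <= M * `|v| * `|q|.
  by move=> xv yq; rewrite (le_trans (bM _ _))// ler_pM ?mulr_ge0// ler_wpM2l.
apply: (le_trans (normc_le _)) => /=.
have := norm_fst_le v; have := norm_snd_le v; move=> v2 v1.
have := norm_fst_le q; have := norm_snd_le q; move=> q2 q1.
have := bb _ _ v1 q1; have := bb _ _ v2 q2.
have := bb _ _ v1 q2; have := bb _ _ v2 q1.
have := ler_normB (b v.1 q.1) (b v.2 q.2).
have := ler_normD (b v.1 q.2) (b v.2 q.1).
rewrite -!mulrA; lra.
Qed.

Lemma complex_bilinearD (V Q : lmodType R) (B B' : V * V -> Q * Q -> R[i]) :
  complex_bilinear B -> complex_bilinear B' ->
  complex_bilinear (fun v q => B v q + B' v q).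
Proof. by move=> [l r] [l' r']; split=> *; rewrite ?l ?l' ?r ?r'; ring. Qed.

Lemma complex_bilinearZ (V Q : lmodType R) (c : R[i]) (B : V * V -> Q * Q -> R[i]) :
  complex_bilinear B -> complex_bilinear (fun v q => c * B v q).
Proof. by move=> [l r]; split=> *; rewrite ?l ?r; ring. Qed.

Lemma bounded_formD (V Q : normedModType R) (B B' : V * V -> Q * Q -> R[i]) :
  bounded_form B -> bounded_form B' -> bounded_form (fun v q => B v q + B' v q).
Proof.
move=> [M M0 BM] [N N0 BN]; exists (M + N) => [|v q]; first exact: addr_ge0.
by rewrite (le_trans (le_normcD _ _))// !mulrDl lerD.
Qed.

Lemma bounded_formZ (V Q : normedModType R) (c : R[i]) (B : V * V -> Q * Q -> R[i]) :
  bounded_form B -> bounded_form (fun v q => c * B v q).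
Proof.
move=> [M M0 BM]; exists (normc c * M) => [|v q].
  by rewrite mulr_ge0// normc_ge0.
by rewrite normcM -!mulrA ler_wpM2l ?normc_ge0// mulrA.
Qed.

End ComplexForms.

Lemma near_normc_lt (R : realType) (e : R) : 0 < e ->
  \forall h \near (0 : R[i]^o)^', normc h < e /\ h != 0.
Proof.
move=> e0; apply/nbhs_ballP; exists (e%:C) => /=; first by rewrite ltcR.
move=> h; rewrite -ball_normE /= sub0r normrN.
by rewrite normc_normE ltcR.
Qed.

(** * Perturbation of a complex saddle point problem *)

Section SaddlePerturbation.
Variables (R : realType) (V Q : completeNormedModType R).
Implicit Types (A : V * V -> V * V -> R[i]) (B : V * V -> Q * Q -> R[i]).
Implicit Types (F : V * V -> R[i]) (G : Q * Q -> R[i]) (s : (V * V) * (Q * Q)).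

Definition solves A B F G s :=
  (forall v, A s.1 v + B v s.2 = F v) /\ (forall q, B s.1 q = G q).

Definition cscale2 (c : R[i]) s := (cscale c s.1, cscale c s.2).

Lemma cscale2_real (a : R) s : cscale2 a%:C s = a *: s.
Proof. by rewrite /cscale2 !cscale_real; case: s. Qed.

Lemma solves_comb A B F G F' G' c s s' :
  complex_bilinear A -> complex_bilinear B ->
  solves A B F G s -> solves A B F' G' s' ->
  solves A B (fun v => c * F v + F' v) (fun q => c * G q + G' q)
    (cscale2 c s + s').
Proof.
move=> [Al _] [Bl Br] [sF sG] [sF' sG']; split=> [v|q] /=.
  by rewrite Al Br -sF -sF'; ring.
by rewrite Bl sG sG'.
Qed.

Section Response.
Variables (A A1 : V * V -> V * V -> R[i]) (B : V * V -> Q * Q -> R[i]).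
Hypotheses (A_bil : complex_bilinear A) (A_bnd : bounded_form A).
Hypotheses (A1_bil : complex_bilinear A1) (A1_bnd : bounded_form A1).
Hypotheses (B_bil : complex_bilinear B) (B_bnd : bounded_form B).

(** The defect of the first equation with data [- A1 w]. Being additive and bounded jointly in
    [(w, s)], it passes to limits, which closes the graph of the response. *)
Let residual (w : V * V) s v := A s.1 v + B v s.2 + A1 w v.

Let residualB w w' s s' v :
  residual (w - w') (s - s') v = residual w s v - residual w' s' v.
Proof.
have [Al _] := A_bil; have [_ Br] := B_bil; have [A1l _] := A1_bil.
have eN (W : lmodType R) (x y : W * W) : x - y = cscale (-1) y + x.
  by rewrite (_ : -1 = (-1)%:C)// ?cscale_real ?scaleN1r 1?addrC// rmorphN.
rewrite /residual /= !eN Al Br A1l; ring.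
Qed.

Let residual_bounded : exists2 M : R, 0 <= M &
  forall w s v, normc (residual w s v) <= M * `|v| * (`|w| + `|s|).
Proof.
have [a a0 aP] := A_bnd; have [b b0 bP] := B_bnd; have [c c0 cP] := A1_bnd.
exists (a + b + c) => [|w s v]; first by rewrite !addr_ge0.
apply: (le_trans (le_normcD _ _)).
apply: (le_trans (lerD (le_normcD _ _) (lexx _))).
apply: (le_trans (lerD (lerD (aP _ _) (bP _ _)) (cP _ _))).
have := norm_fst_le s; have := norm_snd_le s => s2 s1.
have a1 : a * `|s.1| * `|v| <= a * `|s| * `|v| by rewrite ler_wpM2r// ler_wpM2l.
have b1 : b * `|v| * `|s.2| <= b * `|v| * `|s| by rewrite ler_wpM2l// mulr_ge0.
apply: (le_trans (lerD (lerD a1 b1) (lexx _))).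
have : 0 <= a * `|w| * `|v| by rewrite !mulr_ge0.
have : 0 <= b * `|w| * `|v| by rewrite !mulr_ge0.
have : 0 <= c * `|s| * `|v| by rewrite !mulr_ge0.
lra.
Qed.

Lemma solves_response_closed (w : nat -> V * V)
    (s : nat -> (V * V) * (Q * Q)) w0 s0 :
  (forall n, solves A B (fun v => - A1 (w n) v) (fun=> 0) (s n)) ->
  w @ \oo --> w0 -> s @ \oo --> s0 ->
  solves A B (fun v => - A1 w0 v) (fun=> 0) s0.
Proof.
move=> sol ww0 ss0; have [M M0 resM] := residual_bounded.
have [b b0 bP] := B_bnd; have [Bl _] := B_bil.
(* [K] may vanish, hence the division by [K + 1]. *)
have small (x K : R) : 0 <= K ->
    (forall e, 0 < e -> x <= K * e) -> x <= 0.
  move=> K0 xK; apply/ler_addgt0Pr => e e0; rewrite add0r.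
  have K1 : 0 < K + 1 by rewrite ltr_wpDl.
  rewrite (le_trans (xK (e / (K + 1)) _)) ?divr_gt0//.
  rewrite mulrA ler_pdivrMr//; lra.
split=> [v|q].
  apply/eqP; rewrite -addr_eq0; apply/eqP/eq0_normc/le_anti.
  rewrite normc_ge0 andbT -/(residual w0 s0 v).
  apply: (small _ (M * `|v| * 2)) => [|e e0]; first by rewrite !mulr_ge0.
  have [n [wn sn]] : exists n, `|w0 - w n| < e /\ `|s0 - s n| < e.
    have /cvgrPdist_lt/(_ e e0) w_near := ww0.
    have /cvgrPdist_lt/(_ e e0) s_near := ss0.
    by have [n nP] := filter_ex (filterI w_near s_near); exists n.
  (* The residual at [(w n, s n)] is zero, so subtracting it leaves only small arguments. *)
  have -> : residual w0 s0 v = residual (w0 - w n) (s0 - s n) v.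
    rewrite residualB -[LHS]subr0; congr (_ - _).
    by rewrite /residual (sol n).1 addNr.
  rewrite (le_trans (resM _ _ _))// -[leRHS]mulrA ler_wpM2l ?mulr_ge0//.
  lra.
apply/eq0_normc/le_anti; rewrite normc_ge0 andbT.
apply: (small _ (b * `|q|)) => [|e e0]; first by rewrite mulr_ge0.
have /cvgrPdist_lt/(_ e e0) s_near := ss0.
have [n nP] := filter_ex s_near.
have -> : B s0.1 q = B (s0 - s n).1 q.
  rewrite /= addrC -[- _]scaleN1r -cscale_real Bl (sol n).2.
  by rewrite mulr0 add0r.
rewrite (le_trans (bP _ _))// mulrAC ler_wpM2l ?mulr_ge0//.
exact: le_trans (norm_fst_le _) (ltW nP).
Qed.

Hypothesis response_exists : forall w,
  exists s, solves A B (fun v => - A1 w v) (fun=> 0) s.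
Hypothesis homogeneous_trivial : forall s, solves A B (fun=> 0) (fun=> 0) s -> s = 0.

Lemma solves_unique F G s s' : solves A B F G s -> solves A B F G s' -> s = s'.
Proof.
move=> sP sP'; apply/eqP; rewrite -subr_eq0; apply/eqP/homogeneous_trivial.
rewrite addrC -[- s']scaleN1r -cscale2_real.
have := solves_comb (-1)%:C A_bil B_bil sP' sP.
rewrite (_ : (-1)%:C = -1 :> R[i]) ?rmorphN//.
by congr solves; apply/funext => ?; rewrite mulN1r addNr.
Qed.

(** Uniqueness makes the chosen responses linear in [w], and the closed graph theorem turns mere
    solvability into a bound. *)
Lemma response_operator :
  exists (N : {linear (V * V)%type -> ((V * V) * (Q * Q))%type}) (c : R),
  [/\ 0 <= c, forall w, `|N w| <= c * `|w| &
      forall w, solves A B (fun v => - A1 w v) (fun=> 0) (N w)].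
Proof.
have /choice[N NP] := response_exists.
have [A1l _] := A1_bil.
have Ncomb h w w' : N (cscale h w + w') = cscale2 h (N w) + N w'.
  apply: solves_unique (NP _) _.
  have := solves_comb h A_bil B_bil (NP w) (NP w').
  congr solves; apply/funext => v; first by rewrite A1l; ring.
  by rewrite mulr0 addr0.
have Nlin : linear N by move=> a w w'; rewrite -cscale_real Ncomb cscale2_real.
pose L : {linear (V * V)%type -> ((V * V) * (Q * Q))%type} :=
  HB.pack N (GRing.isLinear.Build _ _ _ _ N Nlin).
have [|c c0 cP] := @closed_graph _ _ _ L.
  move=> w w0 s0 ww0 ss0; apply: solves_unique (NP _).
  exact: solves_response_closed ww0 ss0.
by exists L, c.
Qed.

Let Ah (h : R[i]) w v := A w v + h * A1 w v.

Theorem saddle_perturbation F G s0 : solves A B F G s0 ->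
  exists ds, [/\ solves A B (fun v => - A1 s0.1 v) (fun=> 0) ds,
    \forall h \near (0 : R[i]^o)^', exists! s, solves (Ah h) B F G s &
    forall s : R[i] -> (V * V) * (Q * Q),
      (\forall h \near (0 : R[i]^o)^', solves (Ah h) B F G (s h)) ->
      cscale2 h^-1 (s h - s0) @[h --> (0 : R[i]^o)^'] --> ds].
Proof.
move=> s0P; have [N [c [c0 Nc NP]]] := response_operator.
(* Moving [h * A1 s.1] to the right-hand side leaves the unperturbed problem, where superposition
   and uniqueness apply. *)
have solP h s : solves (Ah h) B F G s <-> s = s0 + cscale2 h (N s.1).
  have rhsP := solves_comb h A_bil B_bil (NP s.1) s0P.
  rewrite addrC; split=> [[sF sG]|].
    apply: solves_unique rhsP; split=> [v|q].
      by rewrite -sF /Ah; ring.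
    by rewrite sG mulr0 add0r.
  move=> sE; move: rhsP; rewrite -sE => -[sF sG]; split=> [v|q].
    by rewrite /Ah addrAC sF; ring.
  by rewrite sG mulr0 add0r.
(* For [normc h < e] the factor [2 * normc h * c], with the 2 of [norm_cscale], is at most [1 / 2];
   the [+ 1] covers [c = 0]. *)
pose e := (4 * (c + 1))^-1; have e0 : 0 < e by rewrite invr_gt0 mulr_gt0// ltr_wpDl.
have stepE h w : normc h < e -> `|(cscale2 h (N w)).1| <= 2^-1 * `|w|.
  move=> he; rewrite (le_trans (norm_cscale _ _))//.
  have h0 : 0 <= 2 * normc h by rewrite mulr_ge0// normc_ge0.
  apply: (le_trans (ler_wpM2l h0 (norm_fst_le _))).
  apply: (le_trans (ler_wpM2l h0 (Nc w))); rewrite mulrA ler_wpM2r//.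
  have : normc h * (c + 1) <= 4^-1.
    by rewrite -ler_pdivlMr ?ltr_wpDl// -invfM ltW.
  have := normc_ge0 h; lra.
have uniq h s s' : normc h < e ->
    s = s0 + cscale2 h (N s.1) -> s' = s0 + cscale2 h (N s'.1) -> s = s'.
  move=> he sE s'E; suff : s.1 - s'.1 = 0.
    by move/eqP; rewrite subr_eq0 => /eqP ss'; rewrite sE s'E ss'.
  have dE : s.1 - s'.1 = (cscale2 h (N (s.1 - s'.1))).1.
    rewrite {1}sE {1}s'E /= opprD addrACA subrr add0r -cscaleB.
    by rewrite linearB.
  apply/eqP; rewrite -normr_le0; have := stepE h (s.1 - s'.1) he.
  rewrite -dE; lra.
(* The perturbation is at most half of [|s.1|] and is absorbed on the left. *)
have bound h s : normc h < e -> s = s0 + cscale2 h (N s.1) ->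
    `|s.1| <= 2 * `|s0.1|.
  move=> he sE; have := stepE h s.1 he.
  have := ler_normD s0.1 (cscale2 h (N s.1)).1.
  rewrite -[s0.1 + _]/((s0 + cscale2 h (N s.1)).1) -sE; lra.
exists (N s0.1); split => //.
  near=> h; have [he _] : normc h < e /\ h != 0 by near: h; exact: near_normc_lt.
  (* Only the first component poses a fixed point equation, [w = s0.1 + T w]; the second is then
     explicit. *)
  have Tlin : linear (fun w => (cscale2 h (N w)).1).
    by move=> a w w' /=; rewrite linearP /= cscaleDr -!cscale_real !cscaleA mulrC.
  pose T : {linear (V * V)%type -> (V * V)%type} :=
    HB.pack (fun w => (cscale2 h (N w)).1) (GRing.isLinear.Build _ _ _ _ _ Tlin).
  have [||w wE] := @neumann_surjective _ _ T 2^-1 _ _ s0.1.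
  - by rewrite invr_ge0 ler0n invf_lt1// ltr1n.
  - by move=> w; exact: stepE.
  exists (s0 + cscale2 h (N w)); split; first by apply/solP; rewrite /= -wE.
  by move=> s /solP; apply: uniq => //=; rewrite -wE.
move=> s sP; apply/cvgrPdist_lt => d d0.
(* The error is at most [c * (2 * normc h * c) * (2 * |s0.1|)]; adding 1 keeps [K] positive for the
   threshold [d / K]. *)
pose K := 4 * c ^+ 2 * `|s0.1| + 1.
have K0 : 0 < K by rewrite ltr_wpDl// !mulr_ge0// exprn_ge0.
near=> h.
have [he h0] : normc h < e /\ h != 0 by near: h; exact: near_normc_lt.
have [hd _] : normc h < d / K /\ h != 0.
  by near: h; apply: near_normc_lt; rewrite divr_gt0.
have /solP shE : solves (Ah h) B F G (s h) by near: h.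
have -> : cscale2 h^-1 (s h - s0) = N (s h).1.
  by rewrite {1}shE addrC addKr /cscale2 /= !cscaleA mulVf// !cscale1; case: (N _).
rewrite -linearB (le_lt_trans (Nc _))//.
have -> : s0.1 - (s h).1 = - (cscale2 h (N (s h).1)).1.
  by rewrite {1}shE /= opprD addrA subrr add0r.
rewrite normrN.
have n0 := normc_ge0 h.
have h20 : 0 <= 2 * normc h by rewrite mulr_ge0.
have step := le_trans (norm_cscale h _)
  (ler_wpM2l h20 (le_trans (norm_fst_le _) (Nc (s h).1))).
apply: (le_lt_trans (ler_wpM2l c0 step)).
apply: (@le_lt_trans _ _ (normc h * (4 * c ^+ 2 * `|s0.1|))).
  have := ler_wpM2l (mulr_ge0 (mulr_ge0 c0 h20) c0) (bound h (s h) he shE).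
  by rewrite -!mulrA; lra.
rewrite (@le_lt_trans _ _ (normc h * K)) -?ltr_pdivlMr// ler_wpM2l// lerDl//.
Unshelve. all: by end_near.
Qed.

End Response.
End SaddlePerturbation.

(** * The affine parametrization *)

Section Parametrization.
Variables (R : realType) (d : nat) (D : set 'rV[R]_d).
Variables (K : lmodType R) (ev : K -> 'rV[R]_d -> R) (kap : nat -> K).
Hypothesis ev_lin : forall x, D x -> scalar (ev^~ x).

(** With a single nonzero coefficient, the partial sums are constant from index [j.+1] on. *)
Lemma kappa_real_line (c : R) (j : nat) (x : 'rV[R]_d) :
  kappa_real ev kap (fun i => c * (i == j)%:R) x =
    ev (kap 0) x + c * ev (kap j.+1) x.
Proof.
apply: cvg_lim => //; apply: cvg_near_cst; exists j.+1 => // n /= jn.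
rewrite /kappa_sum (bigD1 (Ordinal jn))//= eqxx mulr1 big1 ?addr0// => i.
by rewrite -val_eqE /= => /negbTE ->; rewrite mulr0 mul0r.
Qed.

Lemma kappa_real_bounds (m M : R) y x : D x -> param_box y ->
  (m%:E < kappa_min D ev kap)%E -> (kappa_max D ev kap < M%:E)%E ->
  m < kappa_real ev kap y x < M.
Proof.
move=> Dx yU mk kM; rewrite -!lte_fin.
have yV : kappa_values D ev kap (kappa_real ev kap y x)%:E by exists x, y.
rewrite (lt_le_trans mk (ereal_inf_lbound yV)).
exact: le_lt_trans (ereal_sup_ubound yV) kM.
Qed.

Lemma kappa_affine_bounds (m M : R) (c : R) j x : D x -> -1 <= c <= 1 ->
  (m%:E < kappa_min D ev kap)%E -> (kappa_max D ev kap < M%:E)%E ->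
  m < ev (kap 0) x + c * ev (kap j.+1) x < M.
Proof.
move=> Dx c1 mk kM; rewrite -kappa_real_line; apply: kappa_real_bounds => // i.
by case: eqP; rewrite ?mulr1// mulr0 lerN10 ler01.
Qed.

Lemma is_kappa_unique z k k' :
  (forall k k', (forall x, D x -> ev k x = ev k' x) -> k = k') ->
  is_kappa D ev kap z k -> is_kappa D ev kap z k' -> k = k'.
Proof.
move=> ev_inj zk zk'; have kk' x : D x -> cval ev k x = cval ev k' x.
  by move=> Dx; exact: (cvg_unique (@norm_hausdorff _ R[i]^o) (zk x Dx) (zk' x Dx)).
rewrite (surjective_pairing k) (surjective_pairing k').
by congr pair; apply: ev_inj => x /kk'[].
Qed.

(** From index [j.+1] on, the partial sums gain exactly the constant [h * kap j.+1], stored as its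
    real and imaginary parts. *)
Lemma is_kappa_shift z k (j : nat) (h : R[i]) : is_kappa D ev kap z k ->
  is_kappa D ev kap (shift z j h)
    (k.1 + complex.Re h *: kap j.+1, k.2 + complex.Im h *: kap j.+1).
Proof.
move=> zk x Dx; have evD a b c : ev (a + b *: c) x = ev a x + b * ev c x.
  by rewrite addrC ev_lin// addrC.
have -> : cval ev (k.1 + complex.Re h *: kap j.+1, k.2 + complex.Im h *: kap j.+1) x
    = cval ev k x + h * (ev (kap j.+1) x)%:C.
  rewrite /cval /= !evD; case: h => a b /=; apply/eqP; rewrite eq_complex /=.
  by apply/andP; split; apply/eqP; ring.
have tail : (h * (ev (kap j.+1) x)%:C : R[i]^o) @[n --> \oo] -->
    (h * (ev (kap j.+1) x)%:C : R[i]^o) by exact: cvg_cst.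
have lim := @cvgD _ R[i]^o _ \oo _ _ _ _ _ (zk x Dx) tail.
apply: (cvg_trans _ (lim _)); apply: near_eq_cvg.
exists j.+1 => // n /= jn; rewrite /kappa_csum -addrA; congr (_ + _).
under [RHS]eq_bigr do rewrite /shift mulrDl.
rewrite big_split /=; congr (_ + _).
rewrite (bigD1 (Ordinal jn))//= eqxx mulr1 big1 ?addr0// => i.
by rewrite -val_eqE /= => /negbTE ->; rewrite mulr0 mul0r.
Qed.

End Parametrization.

(** * Bounds on real forms and dependence on the parameter *)

Lemma bilinear_norm_le (R : realType) (V Q : normedModType R)
    (b : bilinear_form V Q R) (M : R) :
  (forall v q, b v q <= M * `|v| * `|q|) -> forall v q, `|b v q| <= M * `|v| * `|q|.
Proof.
move=> bM v q; rewrite ler_norml bM andbT lerNl -linearNl.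
by rewrite (le_trans (bM _ _))// normrN.
Qed.

Lemma bounded_scalar_continuous (R : realType) (V : normedModType R)
    (f : {scalar V}) (M : R) :
  0 <= M -> (forall v, `|f v| <= M * `|v|) -> continuous f.
Proof.
move=> M0 fM v; apply/cvgrPdist_lt => e e0.
have M1 : 0 < M + 1 by rewrite ltr_wpDl.
apply/nbhs_ballP; exists (e / (M + 1)) => /=; first by rewrite divr_gt0.
move=> w; rewrite -ball_normE /= ltr_pdivlMr// => vw.
rewrite -linearB (le_lt_trans (fM _))// (le_lt_trans _ vw)//.
by rewrite mulrC ler_wpM2l// lerDl.
Qed.

Section ParametricForm.
Variables (R : realType) (K : lmodType R) (V : normedModType R).
Variables (a0 : bilinear_form V V R) (a1 : K -> bilinear_form V V R).
Hypothesis a1_lin : forall w v, scalar (fun k => a1 k w v).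

Lemma a1_shift k k' (t : R) w v : a1 (k + t *: k') w v = a1 k w v + t * a1 k' w v.
Proof. by rewrite addrC (a1_lin w v t k' k) addrC. Qed.

Lemma caform_bilinear k : complex_bilinear (caform a0 a1 k).
Proof.
apply: complex_bilinearD; first exact: cbilin_bilinear.
apply: complex_bilinearD; first exact: cbilin_bilinear.
by apply: complex_bilinearZ; exact: cbilin_bilinear.
Qed.

(** Linearity of [a1] in the parameter makes the perturbation exactly [h] times a fixed form, the
    shape treated by [saddle_perturbation]. *)
Lemma caform_shift k k' (h : R[i]) w v :
  caform a0 a1 (k.1 + complex.Re h *: k', k.2 + complex.Im h *: k') w v =
  caform a0 a1 k w v + h * cbilin (a1 k') w v.
Proof.
rewrite /caform /cbilin /= !a1_shift; case: h => a b /=.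
by apply/eqP; rewrite eq_complex /=; apply/andP; split; apply/eqP; ring.
Qed.

End ParametricForm.

(** * Differentiability of the parametric solution *)

Theorem lemma3p2 (R : realType)
  (* the domain *)
  (d : nat) (hd : d = 2%N \/ d = 3%N) (D : set 'rV[R]_d)
  (D_open : open D) (D_bounded : bounded_set D) (D_lip : lipschitz_boundary D)
  (* the spaces *)
  (V Q : completeNormedModType R) (hV : hilbertian V) (hQ : hilbertian Q)
  (K : completeNormedModType R) (K_sep : separable K)
  (ev : K -> 'rV[R]_d -> R)
  (ev_lin : forall x, D x -> scalar (ev^~ x))
  (ev_inj : forall k k', (forall x, D x -> ev k x = ev k' x) -> k = k')
  (* the forms *)
  (a0 : bilinear_form V V R) (a1 : K -> bilinear_form V V R)
  (b : bilinear_form V Q R)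
  (a1_lin : forall w v, scalar (fun k => a1 k w v))
  (c1 C1 : R) (c1_gt0 : 0 < c1) (C1_gt0 : 0 < C1)
  (* a1 is linear in k: coercivity at both k and - k would force the kernel
     of b to be 0, so it is required at nonnegative k only *)
  (a1_coercive : forall k, (forall x, D x -> 0 <= ev k x) ->
     forall v, kernel_of b v ->
     (c1%:E * ess_inf_on D (fun x => `|ev k x|%R) * (`|v| ^+ 2)%:E
        <= (a1 k v v)%:E)%E)
  (a1_continuous : forall k w v,
     ((a1 k w v)%:E
        <= C1%:E * ess_sup_on D (fun x => `|ev k x|%R) * (`|w| * `|v|)%:E)%E)
  (a1_abs : forall k k', (forall x, D x -> ev k' x = `|ev k x|) ->
     forall w v, a1 k w v <= 2^-1 * (a1 k' w w + a1 k' v v))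
  (delta beta : R) (delta_gt0 : 0 < delta) (beta_gt0 : 0 < beta)
  (b_continuous : forall v q, b v q <= delta * `|v| * `|q|)
  (b_inf_sup : (beta%:E <= inf_sup b)%E)
  (* the affine parametrization *)
  (kap : nat -> K)
  (kap_cvg : forall y, param_box y ->
     exists k, forall x, D x -> kappa_sum ev kap y x @ \oo --> ev k x)
  (theta Theta : R) (theta_gt0 : 0 < theta)
  (kap_range : (theta%:E < kappa_min D ev kap)%E /\
     (kappa_min D ev kap <= kappa_max D ev kap)%E /\
     (kappa_max D ev kap < (Theta / 2)%:E)%E)
  (gamma alpha : R) (gamma_gt0 : 0 < gamma) (alpha_gt0 : 0 < alpha)
  (a_continuous : forall k, (forall x, D x -> theta <= ev k x <= Theta) ->
     forall w v, aform a0 a1 k w v <= gamma * `|w| * `|v|)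
  (a_coercive : forall k, (forall x, D x -> theta <= ev k x <= Theta) ->
     forall v, kernel_of b v -> alpha * `|v| ^+ 2 <= aform a0 a1 k v v)
  (* the complex extension *)
  (r rho : R) (r_gt : theta < r) (rho_lt : rho < Theta)
  (kap_range_r : (r%:E < kappa_min D ev kap)%E /\
     (kappa_min D ev kap < 2%:R%:E * kappa_max D ev kap)%E /\
     (2%:R%:E * kappa_max D ev kap < rho%:E)%E)
  (* unique solvability on the annulus, for the complexified problem *)
  (well_posed : forall z, annulus D ev kap r rho z ->
     forall (f : {scalar V}) (g : {scalar Q}), continuous f -> continuous g ->
     exists! s, saddle_point D ev kap a0 a1 b z (clin f) (clin g) s)
  (* the data, and the solution wherever it is uniquely determined *)
  (f : {scalar V}) (g : {scalar Q}) (hf : continuous f) (hg : continuous g)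
  (u : (nat -> R[i]) -> V * V) (p : (nat -> R[i]) -> Q * Q)
  (up_solution : forall z,
     (exists! s, saddle_point D ev kap a0 a1 b z (clin f) (clin g) s) ->
     saddle_point D ev kap a0 a1 b z (clin f) (clin g) (u z, p z)) :
  forall z, annulus D ev kap r rho z -> forall j : nat,
    (\forall h \near (0 : R[i]^o)^',
       exists! s, saddle_point D ev kap a0 a1 b (shift z j h) (clin f) (clin g) s)
    /\
    exists (du : V * V) (dp : Q * Q),
      [/\ complex_derivative u z j du,
          complex_derivative p z j dp &
          forall s, saddle_point D ev kap a0 a1 b z
                      (fun v => - cbilin (a1 (kap j.+1)) (u z) v) (fun=> 0) s
                    <-> s = (du, dp)].
Proof.
have [k0_min [min_max k0_max]] := kap_range.
have r_min := kap_range_r.1.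
have Theta_gt0 : 0 < Theta.
  have := lt_trans k0_min (le_lt_trans min_max k0_max); rewrite lte_fin.
  by move=> /(lt_trans theta_gt0); rewrite pmulr_lgt0// invr_gt0.
have kap_bounds c i x : D x -> -1 <= c <= 1 ->
    r < ev (kap 0) x + c * ev (kap i.+1) x < Theta / 2.
  by move=> Dx cP; apply: kappa_affine_bounds Dx cP r_min k0_max.
have k0_bounds x : D x -> r < ev (kap 0) x < Theta / 2.
  move=> Dx; have := kap_bounds 0 0%N x Dx.
  by rewrite mul0r addr0; apply; rewrite lerN10 ler01.
have aform_norm k : (forall x, D x -> theta <= ev k x <= Theta) ->
    forall w v, `|a0 w v + a1 k w v| <= gamma * `|w| * `|v|.
  move=> kb w v; rewrite ler_norml (a_continuous _ kb) andbT lerNl opprD.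
  rewrite -!linearNl; have := a_continuous _ kb (- w) v.
  by rewrite normrN.
(* [kap 0 + t k] stays in the range [theta, Theta] for small [t], where
   [a_continuous] applies; the difference with [kap 0] isolates [t a1 k]. *)
have a1_bounded k (M : R) : (forall x, D x -> `|ev k x| <= M) ->
    exists2 C : R, 0 <= C & forall w v, `|a1 k w v| <= C * `|w| * `|v|.
  move=> kM.
  (* [kap 0] stays between [r] and [Theta / 2], so [m] is the room left on both sides, and [t] keeps
     [|t * ev k x|] below it. *)
  pose m := Num.min (r - theta) (Theta / 2); pose t := m / (`|M| + 1).
  have m0 : 0 < m by rewrite lt_min subr_gt0 r_gt divr_gt0.
  have M0 : 0 < `|M| + 1 by rewrite ltr_wpDl.
  have t0 : 0 < t by rewrite divr_gt0.
  have k0b x : D x -> theta <= ev (kap 0) x <= Theta.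
    by move=> /k0_bounds; have := r_gt; have := Theta_gt0; lra.
  have ktb x : D x -> theta <= ev (kap 0 + t *: k) x <= Theta.
    move=> Dx; rewrite addrC ev_lin//.
    have tk : `|t * ev k x| <= m.
      rewrite normrM gtr0_norm// mulrAC ler_pdivrMr// ler_pM2l//.
      by rewrite (le_trans (kM x Dx))// (le_trans (ler_norm M))// lerDl.
    have := k0_bounds x Dx; move: tk; rewrite ler_norml.
    have : m <= r - theta by rewrite ge_min lexx.
    have : m <= Theta / 2 by rewrite ge_min lexx orbT.
    lra.
  exists (2 * gamma / t); first by rewrite divr_ge0 ?mulr_ge0 // ltW.
  move=> w v; have e0 := aform_norm _ k0b w v; have e1 := aform_norm _ ktb w v.
  rewrite (a1_shift a1_lin) in e1.
  have := le_trans (ler_normB _ _) (lerD e1 e0).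
  rewrite opprD addrACA subrr add0r addrAC subrr add0r normrM gtr0_norm// => tb.
  rewrite -(ler_pM2l t0) (le_trans tb)//.
  have -> : t * (2 * gamma / t * `|w| * `|v|) = 2 * (gamma * `|w| * `|v|).
    by field; rewrite gt_eqF.
  by rewrite mulr_natl mulr2n.
have kap_bounded i : forall x, D x -> `|ev (kap i) x| <= Theta.
  move=> x Dx; case: i => [|i].
    by have := k0_bounds x Dx; rewrite ler_norml; lra.
  (* Both [kap 0 + kap i.+1] and [kap 0 - kap i.+1] take values between [r] and [Theta / 2], which
     bounds [kap i.+1] on both sides. *)
  have /(kap_bounds 1 i x Dx) : -1 <= (1 : R) <= 1 by lra.
  have /(kap_bounds (-1) i x Dx) : -1 <= (-1 : R) <= 1 by lra.
  have := k0_bounds x Dx; rewrite ler_norml; lra.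
have a0_bounded : exists2 C : R, 0 <= C & forall w v, `|a0 w v| <= C * `|w| * `|v|.
  have [C C0 CP] := a1_bounded _ _ (kap_bounded 0%N).
  exists (gamma + C) => [|w v]; first by rewrite addr_ge0// ltW.
  have k0b x : D x -> theta <= ev (kap 0) x <= Theta.
    by move=> /k0_bounds; have := r_gt; have := Theta_gt0; lra.
  rewrite -(addrK (a1 (kap 0) w v) (a0 w v)) !mulrDl.
  by rewrite (le_trans (ler_normB _ _))// lerD// aform_norm.
move=> z zA j; have [k zk kA] := zA.
have A_bil := caform_bilinear a0 a1 k.
have kb x : D x -> normc (cval ev k x) <= rho.
  by move=> /kA /andP[_]; rewrite normc_normE lecR.
(* The real and imaginary parts of [k] may leave the range of [a_continuous]; the bound [rho] on the
   modulus suffices for [a1_bounded]. *)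
have A_bnd : bounded_form (caform a0 a1 k).
  have [C0 C00 C0P] := a0_bounded.
  have [C1' C10 C1P] := a1_bounded k.1 rho
    (fun x Dx => le_trans (Re_le_normc (cval ev k x)) (kb x Dx)).
  have [C2' C20 C2P] := a1_bounded k.2 rho
    (fun x Dx => le_trans (Im_le_normc (cval ev k x)) (kb x Dx)).
  apply: bounded_formD; first exact: cbilin_bounded C0P.
  apply: bounded_formD; first exact: cbilin_bounded C1P.
  by apply: bounded_formZ; exact: cbilin_bounded C2P.
have [Cj Cj0 CjP] := a1_bounded _ _ (kap_bounded j.+1).
have Aj_bil := cbilin_bilinear (a1 (kap j.+1)).
have Aj_bnd := cbilin_bounded Cj0 CjP.
have B_bil := cbilin_bilinear b.
have B_bnd := cbilin_bounded (ltW delta_gt0) (bilinear_norm_le b_continuous).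
have saddleP F G s : saddle_point D ev kap a0 a1 b z F G s <->
    solves (caform a0 a1 k) (cbilin b) F G s.
  split=> [[k' zk' sP]|]; last by exists k.
  by rewrite (is_kappa_unique ev_inj zk zk').
have zero_cont (W : normedModType R) : continuous (\0 : W -> R).
  by move=> w; exact: cvg_cst.
(* Well-posedness for zero data: both [s] and 0 equal its unique solution. *)
have homogeneous s :
    solves (caform a0 a1 k) (cbilin b) (fun=> 0) (fun=> 0) s -> s = 0.
  have [s1 [_ s1u]] := well_posed _ zA _ _ (zero_cont V) (zero_cont Q).
  move=> sP; transitivity s1.
    apply/esym/s1u/saddleP; split=> v; first by rewrite sP.1.
    by rewrite sP.2.
  apply: s1u; apply/saddleP; split=> v.
    by rewrite (complex_bilinear0l _ A_bil) (complex_bilinear0r _ B_bil) addr0.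
  by rewrite (complex_bilinear0l _ B_bil).
(* [well_posed] covers real functionals only, so the data of [w.1] and [w.2] are solved separately
   and recombined with the imaginary unit. *)
have response w : exists s, solves (caform a0 a1 k) (cbilin b)
    (fun v => - cbilin (a1 (kap j.+1)) w v) (fun=> 0) s.
  have a1_cont x : continuous (a1 (kap j.+1) x).
    apply: (@bounded_scalar_continuous _ _ _ (Cj * `|x|)) => [|v]; last exact: CjP.
    by rewrite mulr_ge0.
  have [s1 [/saddleP s1P _]] := well_posed _ zA _ _ (a1_cont (- w.1)) (zero_cont Q).
  have [s2 [/saddleP s2P _]] := well_posed _ zA _ _ (a1_cont (- w.2)) (zero_cont Q).
  exists (cscale2 (0 +i* 1) s2 + s1).
  have := solves_comb (0 +i* 1) A_bil B_bil s2P s1P.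
  congr solves; apply/funext => v.
    rewrite /clin /cbilin /= !linearNl; apply/eqP; rewrite eq_complex /=.
    by apply/andP; split; apply/eqP; ring.
  rewrite /clin /=; apply/eqP.
  by rewrite eq_complex /= !(mulr0, mul0r, addr0, subrr, eqxx).
have /up_solution/saddleP s0P := well_posed _ zA _ _ hf hg.
have [ds [dsP ds_uniq ds_lim]] := saddle_perturbation A_bil A_bnd Aj_bil Aj_bnd
  B_bil B_bnd response homogeneous s0P.
have shiftP h F G s : saddle_point D ev kap a0 a1 b (shift z j h) F G s <->
    solves (fun w v => caform a0 a1 k w v + h * cbilin (a1 (kap j.+1)) w v)
      (cbilin b) F G s.
  have zh := is_kappa_shift ev_lin (j := j) (h := h) zk.
  split=> [[k' zk' [sF sG]]|[sF sG]].
    rewrite -(is_kappa_unique ev_inj zh zk') in sF.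
    by split=> // v; rewrite -(caform_shift _ a1_lin).
  by eexists; [exact: zh|split=> // v; rewrite (caform_shift _ a1_lin)].
(* The shifted parameter may leave the annulus, so unique solvability there comes from the
   perturbation theorem; [up_solution] then identifies [u] and [p]. *)
have near_uniq : \forall h \near (0 : R[i]^o)^', exists! s,
    saddle_point D ev kap a0 a1 b (shift z j h) (clin f) (clin g) s.
  near=> h; have [s [sP su]] : exists! s, solves
      (fun w v => caform a0 a1 k w v + h * cbilin (a1 (kap j.+1)) w v)
      (cbilin b) (clin f) (clin g) s by near: h.
  by exists s; split=> [|s' /shiftP]; [exact/shiftP|exact: su].
split=> //; exists ds.1, ds.2.
have {}ds_lim := ds_lim (fun h => (u (shift z j h), p (shift z j h))).
have /ds_lim {}ds_lim : \forall h \near (0 : R[i]^o)^', solves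
      (fun w v => caform a0 a1 k w v + h * cbilin (a1 (kap j.+1)) w v)
      (cbilin b) (clin f) (clin g) (u (shift z j h), p (shift z j h)).
  by apply: filterS near_uniq => h /up_solution/shiftP.
split.
- exact: cvg_comp ds_lim (@cvg_fst _ _ _ _ _).
- exact: cvg_comp ds_lim (@cvg_snd _ _ _ _ _).
- move=> s; rewrite -surjective_pairing; split=> [/saddleP sP|->].
    exact: (solves_unique A_bil B_bil homogeneous sP dsP).
  exact/saddleP.
Unshelve. all: by end_near.
Qed.
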